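(* Let $0<p<1$, let $K\subseteq\mathbb{R}$ be a $p$-convex set, and let $F=(f_1,\ldots,f_m):K\to\mathbb{R}^m_+$ be an $\mathbb{R}^m_+$-$p$-convex mapping. If $\bar x\in E_W$ and $\bar x>0$, then $(0,\bar x]\subseteq E_W$. Similarly, if $\bar x\in E_W$ and $\bar x<0$, then $[\bar x,0)\subseteq E_W$.
   Context: For $0<p\le 1$, a set $K\subseteq\mathbb{R}^n$ is called $p$-convex if $\lambda x+\mu y\in K$ for every $x,y\in K$ and all $\lambda,\mu\ge 0$ with $\lambda^p+\mu^p=1$. $\mathbb{R}^m_+$ is the set of vectors in $\mathbb{R}^m$ with nonnegative coordinates ($m\ge 1$). For a $p$-convex set $K$, a mapping $F:K\to\mathbb{R}^m$ is $\mathbb{R}^m_+$-$p$-convex if $\lambda F(x)+\mu F(y)\in F(\lambda x+\mu y)+\mathbb{R}^m_+$ for all $x,y\in K$ and all $\lambda,\mu\ge 0$ with $\lambda^p+\mu^p=1$. A point $\bar x\in K$ is a weakly efficient point of $F$ on $K$ if $F(x)-F(\bar x)\in\mathbb{R}^m\setminus(-\mathrm{int}\,\mathbb{R}^m_+)$ for all $x\in K$, i.e. there is no $x\in K$ with $f_i(x)<f_i(\bar x)$ for all $i$. $E_W=E_W(K)$ denotes the set of weakly efficient points of $F$ on $K$. The intervals $(0,\bar x]$ and $[\bar x,0)$ are ordinary real intervals. *)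

(* Defs.v *)
From HB Require Import structures.
From mathcomp Require Import all_boot all_order all_algebra.
From mathcomp Require Import all_classical all_reals all_analysis.

Set Implicit Arguments.
Unset Strict Implicit.
Unset Printing Implicit Defensive.

Import Order.TTheory GRing.Theory Num.Theory.
Import numFieldNormedType.Exports.

Local Open Scope classical_set_scope.
Local Open Scope ring_scope.

Definition p_convex (R : realType) (V : lmodType R) (p : R) (K : set V) : Prop :=
  forall (x y : V) (lam mu : R), K x -> K y -> 0 <= lam -> 0 <= mu ->
    lam `^ p + mu `^ p = 1 -> K (lam *: x + mu *: y).

Definition nonneg_orthant (R : realType) (m : nat) : set 'rV[R]_m :=
  [set v | forall i, 0 <= v 0 i].
Arguments nonneg_orthant : clear implicits.

(* A mapping [K -> R^m] is represented by a total function of which only the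
   values on [K] matter. *)
Definition orthant_p_convex (R : realType) (V : lmodType R) (m : nat) (p : R)
    (K : set V) (F : V -> 'rV[R]_m) : Prop :=
  forall (x y : V) (lam mu : R), K x -> K y -> 0 <= lam -> 0 <= mu ->
    lam `^ p + mu `^ p = 1 ->
    [set F (lam *: x + mu *: y) + c | c in nonneg_orthant R m]
      (lam *: F x + mu *: F y).

Definition weakly_efficient (R : realType) (V : lmodType R) (m : nat)
    (K : set V) (F : V -> 'rV[R]_m) : set V :=
  [set xbar | K xbar /\ forall x, K x ->
    (~` [set - c | c in interior (nonneg_orthant R m)]) (F x - F xbar)].

(* Main.v *)
(* For [0 < p < 1], the sums [lam + mu] with [lam `^ p + mu `^ p = 1] fill an
   interval [[c, 1]] with [0 < c < 1].  Taking [y = x] in the two convexity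
   hypotheses, [K] is stable under scaling by [t] in [[c, 1]] and
   [F (t x) <= t F x] there; iterating, this holds for all [t] in [(0, 1]].
   As [F] is nonnegative, [F (t x) <= F x], so a point strictly dominating
   [t x] would strictly dominate [x]. *)
Require Import Defs.
From HB Require Import structures.
From mathcomp Require Import all_boot all_order all_algebra.
From mathcomp Require Import all_classical all_reals all_analysis.
From mathcomp Require Import lra.

Import Order.TTheory GRing.Theory Num.Theory.
Import numFieldNormedType.Exports.

Local Open Scope classical_set_scope.
Local Open Scope ring_scope.

Lemma continuous_powR (R : realType) (q x : R) : 0 < x ->
  {for x, continuous (fun a : R => a `^ q)}.
Proof.
move=> x0; apply/differentiable_continuous/derivable1_diffP.
by apply: derivable_powR; rewrite in_itv /= x0.
Qed.

(** Continuity of a power is available at positive bases. The bound [b < 1] keeps [1 - u] positive,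
    so only [u = 0] needs a separate, one-sided limit. *)
Lemma continuous_powR_sum (R : realType) (q b : R) : 0 < q -> 0 < b < 1 ->
  {within `[0, b], continuous (fun u : R => u `^ q + (1 - u) `^ q)}.
Proof.
move=> q0 /andP[b0 b1].
have cB u : u < 1 -> {for u, continuous (fun v : R => (1 - v) `^ q)}.
  move=> u1.
  apply: (@continuous_comp _ _ _ (fun v : R => 1 - v) (fun v : R => v `^ q)).
    by apply: continuousB; [exact: cst_continuous | exact: cvg_id].
  by apply: continuous_powR; rewrite subr_gt0.
have cS u : 0 < u -> u < 1 ->
    {for u, continuous (fun v : R => v `^ q + (1 - v) `^ q)}.
  by move=> u0 u1; apply: continuousD; [exact: continuous_powR | exact: cB].
apply/(continuous_within_itvP _ b0); split.
- move=> u; rewrite in_itv /= => /andP[u0 ub].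
  exact: cS u0 (lt_trans ub b1).
- apply: cvgD; last by apply: cvg_at_right_filter; exact: cB.
  by rewrite powR0 ?gt_eqF//; exact: powR_cvg0.
- by apply: cvg_at_left_filter; exact: cS.
Qed.

Lemma powR_half_lt (R : realType) (q : R) : 1 < q -> (2^-1 : R) `^ q < 2^-1.
Proof.
move=> q1; have h0 : (0 : R) < 2^-1 by rewrite invr_gt0.
rewrite -(mulr_powRB1 (ltW h0)) ?(lt_trans _ q1)//.
rewrite gtr_pMr//.
suff : (2^-1 : R) `^ (q - 1) < 1 `^ (q - 1) by rewrite powR1.
apply: gt0_ltr_powR; rewrite ?nnegrE ?subr_gt0 ?ler01 ?(ltW h0)//.
by rewrite invf_lt1 ?ltr1n.
Qed.

(** The admissible pairs are parametrised by [lam = u^(1/p)] and [mu = (1 - u)^(1/p)]. Their sum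
    [g u] is 1 at [u = 0] and [2 * 2^(-1/p) < 1] at [u = 1/2], so the intermediate value theorem
    applies with [c = g (1/2)]. *)
Lemma powR_sum1_cover (R : realType) (p : R) : 0 < p -> p < 1 ->
  exists2 c : R, 0 < c < 1 & forall t, c <= t <= 1 ->
    exists lam mu : R,
      [/\ 0 <= lam, 0 <= mu, lam `^ p + mu `^ p = 1 & lam + mu = t].
Proof.
move=> p0 p1; have q0 : 0 < p^-1 by rewrite invr_gt0.
have q1 : 1 < p^-1 by rewrite invf_gt1.
have h0 : (0 : R) < 2^-1 by rewrite invr_gt0.
pose g (u : R) := u `^ p^-1 + (1 - u) `^ p^-1.
have g0 : g 0 = 1 by rewrite /g powR0 ?gt_eqF// subr0 powR1 add0r.
have gh : g 2^-1 = 2^-1 `^ p^-1 + 2^-1 `^ p^-1.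
  by rewrite /g; congr (_ + _ `^ _); lra.
have h1 := @powR_half_lt R _ q1.
have h2 : 0 < (2^-1 : R) `^ p^-1 by rewrite powR_gt0.
have c01 : 0 < g 2^-1 < 1 by rewrite gh; lra.
exists (g 2^-1) => // t /andP[ct t1].
have cg : {within `[0, 2^-1], continuous g}.
  by apply: continuous_powR_sum => //; rewrite h0 /=; lra.
have [|u] := @IVT R g 0 2^-1 t (ltW h0) cg.
  by rewrite g0 ge_min le_max ct t1 orbT.
rewrite in_itv /= => /andP[u0 uh] gu.
exists (u `^ p^-1), ((1 - u) `^ p^-1); split => //; try exact: powR_ge0.
rewrite -!powRrM mulVf ?gt_eqF// !powRr1//; lra.
Qed.

(** By induction on [n], [P] holds on [[c^(n+1), 1]]; these intervals exhaust [(0, 1]] because the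
    powers of [c] tend to 0. *)
Lemma unit_scaling_ind (R : realType) (P : R -> Prop) (c : R) : 0 < c < 1 ->
  (forall t, c <= t <= 1 -> P t) -> (forall s t : R, 0 < s -> P s -> P t -> P (s * t)) ->
  forall t, 0 < t <= 1 -> P t.
Proof.
move=> /andP[c0 c1] Pc PM.
have Pn n t : c ^+ n.+1 <= t <= 1 -> P t.
  elim: n t => [|n IH] t; first exact: Pc.
  move=> /andP[ct t1]; have [tc|tc] := leP c t; first by apply: Pc; rewrite tc.
  (* Here [t <= c], so [t = c * (t / c)] with [t / c] in the interval of the induction
     hypothesis. *)
  rewrite -[t](divfK (lt0r_neq0 c0)) mulrC; apply: PM => //.
    by apply: Pc; rewrite lexx ltW.
  by apply: IH; rewrite ler_pdivlMr// ler_pdivrMr// -exprSr ct mul1r ltW.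
move=> t /andP[t0 t1].
have /cvg_expr/cvgr0_norm_lt/(_ _ t0)[N _ /(_ N.+1 (leqnSn N))] : `|c| < 1.
  by rewrite gtr0_norm.
rewrite /= ger0_norm ?exprn_ge0 1?ltW// => cNt.
by apply: (Pn N); rewrite ltW.
Qed.

Lemma orthant_p_convex_scale (R : realType) (V : lmodType R) (m : nat) (p : R)
    (K : set V) (F : V -> 'rV[R]_m) :
  0 < p -> p < 1 -> p_convex p K -> orthant_p_convex p K F ->
  forall t x, 0 < t <= 1 -> K x ->
    K (t *: x) /\ forall i, F (t *: x) 0 i <= t * F x 0 i.
Proof.
(* The point [x] stays quantified in the induction predicate, since the product step uses the factor
   [s] at [t *: x]. *)
move=> p0 p1 hK hF t x t01; move: t t01 x.
have [c c01 cover] := powR_sum1_cover _ _ p0 p1.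
apply: (unit_scaling_ind _ _ _ c01) => [t /cover[lam [mu [l0 m0 lm <-]]] x Kx|s t s0 Ps Pt x Kx].
  rewrite scalerDl; split; first exact: hK.
  move=> i; have [d d0 /matrixP/(_ 0 i)] := hF x x lam mu Kx Kx l0 m0 lm.
  by rewrite !mxE -mulrDl => <-; rewrite lerDl.
have [Ktx Ftx] := Pt x Kx; have [Kstx Fstx] := Ps _ Ktx.
rewrite -scalerA; split=> // i; apply: le_trans (Fstx i) _.
by rewrite -mulrA ler_pM2l.
Qed.

(** The translate of the orthant by [d] is a neighbourhood of [c + d], and it lies in the orthant
    because [d] is nonnegative. *)
Lemma interior_nonneg_orthantD (R : realType) (m : nat) (c d : 'rV[R]_m) :
  (nonneg_orthant R m)^° c -> nonneg_orthant R m d ->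
  (nonneg_orthant R m)^° (c + d).
Proof.
move=> ic d0.
have /(_ (c + d)) cB : continuous (fun z : 'rV[R]_m => z - d).
  by move=> z; apply: continuousB; [exact: cvg_id | exact: cst_continuous].
have : nbhs (c + d) ((fun z : 'rV[R]_m => z - d) @^-1` nonneg_orthant R m).
  by apply: cB; rewrite addrK.
apply: filterS => z zd i; have := addr_ge0 (zd i) (d0 i).
by rewrite !mxE subrK.
Qed.

Lemma weakly_efficient_le (R : realType) (V : lmodType R) (m : nat)
    (K : set V) (F : V -> 'rV[R]_m) (x y : V) :
  weakly_efficient K F x -> K y -> (forall i, F y 0 i <= F x 0 i) ->
  weakly_efficient K F y.
Proof.
move=> [_ Ex] Ky Fyx; split=> // z Kz [c ic ecz]; apply: (Ex z Kz).
(* With [c = F y - F z] interior, this witness is [F x - F z]. *)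
exists (c + (F x - F y)); last by rewrite opprD ecz opprB subrKA.
by apply: interior_nonneg_orthantD ic _ => // i; rewrite !mxE subr_ge0.
Qed.

Lemma weakly_efficient_scale (R : realType) (V : lmodType R) (m : nat) (p : R)
    (K : set V) (F : V -> 'rV[R]_m) (t : R) (x : V) :
  0 < p -> p < 1 -> p_convex p K -> orthant_p_convex p K F ->
  (forall y, K y -> nonneg_orthant R m (F y)) ->
  0 < t <= 1 -> weakly_efficient K F x -> weakly_efficient K F (t *: x).
Proof.
move=> p0 p1 hK hF F0 t01 Ex; have Kx := Ex.1.
have [Ktx Ftx] := orthant_p_convex_scale _ _ _ _ _ _ p0 p1 hK hF _ _ t01 Kx.
apply: (weakly_efficient_le _ _ _ _ _ _ _ Ex Ktx) => i; apply: le_trans (Ftx i) _.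
by case/andP: t01 => _ t1; rewrite ler_piMl// F0.
Qed.

(* The scalar line is [R^o], the ring [R] seen as a module over itself. *)
Theorem corollary6p6 (R : realType) (m : nat) (hm : (0 < m)%N) (p : R)
    (hp0 : 0 < p) (hp1 : p < 1) (K : set R^o) (hK : p_convex p K)
    (F : R^o -> 'rV[R]_m)
    (hFnonneg : forall x : R^o, K x -> nonneg_orthant R m (F x))
    (hF : orthant_p_convex p K F) :
  (forall xbar : R, weakly_efficient K F xbar -> 0 < xbar ->
     [set` `]0, xbar]] `<=` weakly_efficient K F) /\
  (forall xbar : R, weakly_efficient K F xbar -> xbar < 0 ->
     [set` `[xbar, 0[] `<=` weakly_efficient K F).
Proof.
(* Writing [y] as [(y / x) * x] treats both signs of [x] at once. *)
have main (x y : R) : weakly_efficient K F x -> x != 0 -> 0 < y / x <= 1 ->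
    weakly_efficient K F y.
  move=> Ex x0 yx; rewrite -(divfK x0 y).
  exact: (weakly_efficient_scale _ _ _ _ _ _ _ _ hp0 hp1 hK hF hFnonneg yx Ex).
split=> x Ex x0 y /=; rewrite in_itv /= => /andP[y1 y2]; apply: (main x) => //.
- by rewrite gt_eqF.
- by rewrite divr_gt0//= ler_pdivrMr// mul1r.
- by rewrite lt_eqF.
- by rewrite ler_ndivrMr// mul1r y1 andbT nmulr_lgt0// invr_lt0.
Qed.
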